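(* For every positive integer $n$, let $\alpha(n)$ be the number of solutions, with $m_1,m_2,m_3\in\mathbb N_0$ arbitrary and $(\boldsymbol n,\boldsymbol a,\boldsymbol b,\boldsymbol c)\in\mathbb Z^3\times\mathbb N^{m_1}\times\mathbb N^{m_2}\times(\mathbb Z\setminus\{0\})^{m_3}$, of the equation $$n=2\sum_{j=1}^3 n_j^2+\sum_{j=1}^{m_1}T_{a_j}+\sum_{j=1}^{m_2}T_{b_j}+\sum_{j=1}^{m_3}P_5(c_j),$$ where each solution is counted with weight $(-1)^{\sum_{j=1}^3 n_j+m_1+m_2+m_3+\sum_{j=1}^{m_3}c_j}$. Then $$\operatorname{sgn}(\alpha(n))=\begin{cases}1&\text{if }n\equiv 0,3\pmod 4,\\ -1&\text{if }n\equiv 1,2\pmod 4.\end{cases}$$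
   Context: $\mathbb N=\{1,2,\dots\}$, $\mathbb N_0=\mathbb N\cup\{0\}$. $T_m:=\frac{m(m+1)}{2}$ is the $m$-th triangular number and, for $m\in\mathbb Z$, $P_5(m):=\frac{3m^2-m}{2}$ is the $m$-th generalized pentagonal number. The vectors $\boldsymbol a,\boldsymbol b,\boldsymbol c$ are ordered tuples of lengths $m_1,m_2,m_3$ (empty if the length is $0$). For each $n$ there are finitely many solutions. $\operatorname{sgn}(x)\in\{-1,0,1\}$ is the sign of $x$. *)

(* Defs.v *)
From mathcomp Require Import all_boot all_order all_algebra.
From mathcomp Require Import all_classical.

Set Implicit Arguments.
Unset Strict Implicit.
Unset Printing Implicit Defensive.

Import Order.TTheory GRing.Theory Num.Theory.
Local Open Scope ring_scope.
Local Open Scope classical_set_scope.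

Definition triangular (m : nat) : nat := ((m * m.+1) %/ 2)%N.

(* The numerator is always even, so the Euclidean quotient is exact. *)
Definition pentagonal (m : int) : int := ((3 * m ^+ 2 - m) %/ 2)%Z.

(* A candidate (n, a, b, c). A tuple of arbitrary length m is a sequence; the
   length m is its size. *)
Definition candidate : Type :=
  ({ffun 'I_3 -> int} * seq nat * seq nat * seq int)%type.

Definition is_solution (n : nat) (s : candidate) : Prop :=
  let: (v, a, b, c) := s in
  [/\ {in a, forall x, (0 < x)%N},
      {in b, forall x, (0 < x)%N},
      {in c, forall x, x != 0} &
      n%:Z = 2 * (\sum_(j < 3) v j ^+ 2)
             + \sum_(x <- a) (triangular x)%:Z
             + \sum_(x <- b) (triangular x)%:Z
             + \sum_(x <- c) pentagonal x].

(* The exponent is an integer, possibly negative; -1 is its own inverse in the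
   ring int, so this is the usual sign. *)
Definition weight (s : candidate) : int :=
  let: (v, a, b, c) := s in
  (-1) ^ (\sum_(j < 3) v j
          + (size a)%:Z + (size b)%:Z + (size c)%:Z
          + \sum_(x <- c) x).

(* The solution set is finite for every n, and the weight never vanishes, so
   this finitely supported sum is the full weighted count. *)
Definition alpha (n : nat) : int :=
  \sum_(s \in [set s : candidate | is_solution n s]) weight s.

(* Main.v *)
Require Import Defs.
From mathcomp Require Import all_boot all_order all_algebra.
From mathcomp Require Import all_classical.
From mathcomp Require Import zify ring.
Import Order.TTheory GRing.Theory Num.Theory.
Local Open Scope ring_scope.

Set Implicit Arguments.
Unset Strict Implicit.
Unset Printing Implicit Defensive.

(** Write (x; Q) for the infinite product of the 1 - x Q^m over m >= 0, and J_k for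
    (q^k; q^k).

    A tuple of arbitrary length contributes a geometric series: summing the sign
    (-1)^m over all m-tuples of positive triangular numbers gives 1 / psi, where psi
    is the sum of q^(T_a) over a >= 0, and the pentagonal tuples give 1 divided by the
    sum of (-1)^c q^(P_5(c)) over all integers c.  Hence the generating function of
    alpha is G = phi^3 / (psi^2 euler), where phi is the sum of (-1)^k q^(2 k^2).
    By the Jacobi triple product, phi = (q^2; q^4)^2 J_4,
    psi = (-q; q^4) (-q^3; q^4) J_4 and euler = J_1, and cancelling factors leaves
      G = (q; q^4) (q^3; q^4) (q^2; q^4)^3 = psi(-q) (q^2; q^4)^3 / J_4.
    The only factor in which odd powers of q occur is psi(-q), the sum of
    (-1)^k q^(2 k^2 - k).  Splitting it by the parity of k and applying the triple
    product to both halves gives G = E(-q^2) - q O(-q^2) with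
      E = (-q; q^8) (-q^7; q^8) (-q; q^2)^2 / ((q^2; q^16) (q^4; q^16) (q^12; q^16) (q^14; q^16)),
      O = (-q^3; q^8) (-q^5; q^8) (-q; q^2)^2 / ((q^4; q^16) (q^6; q^16) (q^10; q^16) (q^12; q^16)).
    Both are products of polynomials and geometric series with nonnegative
    coefficients, and all their coefficients are visibly positive: E contains the
    factors 1 + q and 1 / (1 - q^2), and O contains 1 + q twice, 1 + q^3 and
    1 / (1 - q^4).  So alpha(2 m) has the sign of (-1)^m and alpha(2 m + 1) that of
    -(-1)^m, which is the claim.

    Formal power series are replaced by a commutative ring with an element q such
    that q^M = 0; every infinite product and theta series is then a finite one.  The
    series identities hold in any such ring ([theta_quotient_dissection]), and
    coefficients are read off at the end in the ring of integer polynomials modulo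
    X^M ([alpha_dissected]). *)

(** * The finite Jacobi triple product *)

(** The triangular number k (k + 1) / 2 for every integer k; since it is invariant
    under k |-> -k - 1, both constructors of the integers have the same value. *)
Definition tri (k : int) : nat :=
  match k with Posz m | Negz m => 'C(m.+1, 2) end.

Lemma triE (k : int) : (tri k)%:Z * 2 = k * (k + 1).
Proof.
have H (m : nat) : ('C(m.+1, 2))%:Z * 2 = m%:Z * (m%:Z + 1).
  have := bin_ffact m.+1 2; rewrite ffactnSr ffactn1 (_ : 2`! = 2)%N //; lia.
by case: k => m; rewrite H ?NegzE //; ring.
Qed.

Definition qpoch {R : comNzRingType} (x Q : R) (n : nat) : R :=
  \prod_(i < n) (1 - x * Q ^+ i).

(** The Gaussian binomial coefficient, by the Pascal rule that it satisfies as a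
    polynomial in Q; no division is needed, so Q may be nilpotent. *)
Fixpoint qbinom {R : comNzRingType} (Q : R) (n k : nat) : R :=
  match n, k with
  | _, 0 => 1
  | 0, _.+1 => 0
  | n'.+1, k'.+1 => qbinom Q n' k' + Q ^+ k * qbinom Q n' k
  end.

Section FiniteProducts.
Variable R : comNzRingType.
Implicit Types (x y Q : R) (n k : nat).

Lemma qpoch0 x Q : qpoch x Q 0 = 1.
Proof. by rewrite /qpoch big_ord0. Qed.

Lemma qpochS x Q n : qpoch x Q n.+1 = qpoch x Q n * (1 - x * Q ^+ n).
Proof. by rewrite /qpoch big_ord_recr. Qed.

Lemma qpochSl x Q n : qpoch x Q n.+1 = (1 - x) * qpoch (x * Q) Q n.
Proof.
rewrite /qpoch big_ord_recl expr0 mulr1; congr (_ * _).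
by apply: eq_bigr => i _; rewrite exprS mulrA.
Qed.

Lemma qpoch_split x Q k n :
  qpoch x Q (k * n) = \prod_(i < k) qpoch (x * Q ^+ i) (Q ^+ k) n.
Proof.
elim: n => [|n IH].
  by rewrite muln0 qpoch0 big1 // => i _; rewrite qpoch0.
under eq_bigr => i _ do rewrite qpochS.
rewrite big_split /= -IH mulnS addnC.
rewrite /qpoch big_split_ord /=; congr (_ * _).
by apply: eq_bigr => i _; rewrite -mulrA -exprM -exprD addnC.
Qed.

Lemma qpoch_pm x Q n :
  qpoch x Q n * qpoch (- x) Q n = qpoch (x ^+ 2) (Q ^+ 2) n.
Proof.
rewrite /qpoch -big_split /=; apply: eq_bigr => i _.
rewrite -exprM mulnC exprM; ring.
Qed.

Lemma qbinom_gt Q n k : (n < k)%N -> qbinom Q n k = 0.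
Proof.
elim: n k => [|n IH] [|k] //= lt_nk.
by rewrite !IH ?mulr0 ?addr0 // ltnW.
Qed.

Lemma qbinom0 Q n : qbinom Q n 0 = 1. Proof. by case: n. Qed.

(** The usual quotient of q-factorials, with the denominators multiplied out. *)
Lemma qbinom_qpoch Q n k : (k <= n)%N ->
  qbinom Q n k * qpoch Q Q k * qpoch Q Q (n - k) = qpoch Q Q n.
Proof.
elim: n k => [|n IH] [|k] //; rewrite ?qpoch0 ?qbinom0 ?subn0 ?mul1r ?mulr1 //.
rewrite ltnS subSS => le_kn /=.
have Hk := IH k le_kn.
move: le_kn; rewrite leq_eqVlt => /orP[/eqP eq_kn|lt_kn].
  rewrite -eq_kn subnn qpoch0 mulr1 in Hk *.
  by rewrite (@qbinom_gt Q k k.+1) // mulr0 addr0 qpochS mulr1 mulrA Hk.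
have Hk1 := IH k.+1 lt_kn.
have e : (n - k = (n - k.+1).+1)%N by lia.
have eQ : Q * Q ^+ n = Q ^+ k.+1 * (Q * Q ^+ (n - k.+1)).
  by rewrite -!exprS -exprD; congr (_ ^+ _); lia.
rewrite [in RHS]qpochS eQ.
transitivity (qbinom Q n k * qpoch Q Q k * qpoch Q Q (n - k) * (1 - Q ^+ k.+1)
   + Q ^+ k.+1 * (qbinom Q n k.+1 * qpoch Q Q k.+1 * qpoch Q Q (n - k.+1)
     * (1 - Q * Q ^+ (n - k.+1)))).
  rewrite e !qpochS -exprS; ring.
by rewrite Hk Hk1; ring.
Qed.

(** The k-th term of Ramanujan's theta function f(x, y). *)
Definition triple_term x y (k : int) : R := x ^+ tri k * y ^+ tri (k - 1).

(** Multiplying by one more factor 1 + y (x y)^s of the product turns the term of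
    index j - s into that of index j - s - 1, at the cost of the power (x y)^j: this
    power is the one in the Pascal rule. *)
Lemma triple_term_shift x y s (j : nat) :
  triple_term x y (j%:Z - s.+1%:Z) * (x * y) ^+ j =
  triple_term x y (j%:Z - s%:Z) * y * (x * y) ^+ s.
Proof.
rewrite /triple_term !exprMn.
rewrite [LHS](_ : _ = (x ^+ tri (j%:Z - s.+1%:Z) * x ^+ j) *
   (y ^+ tri (j%:Z - s.+1%:Z - 1) * y ^+ j)); last by ring.
rewrite [RHS](_ : _ = (x ^+ tri (j%:Z - s%:Z) * x ^+ s) *
   (y ^+ tri (j%:Z - s%:Z - 1) * y ^+ s * y)); last by ring.
rewrite -!exprD -exprSr.
have := triE (j%:Z - s.+1%:Z); have := triE (j%:Z - s%:Z - 1).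
have := triE (j%:Z - s.+1%:Z - 1); have := triE (j%:Z - s%:Z).
have -> : s.+1%:Z = s%:Z + 1 by lia.
move=> H1 H2 H3 H4.
by congr (_ ^+ _ * _ ^+ _); nia.
Qed.

(** This is the q-binomial theorem.  Taking the first factor out of the product
    replaces z by z Q in the others, which matches the Pascal rule that defines
    [qbinom]; for this reason the induction quantifies over z. *)
Lemma finite_triple_right x y r :
  qpoch (- x) (x * y) r = \sum_(j < r.+1) qbinom (x * y) r j * triple_term x y j.
Proof.
set Q := x * y.
have jE (j : nat) : triple_term x y j = Q ^+ 'C(j, 2) * x ^+ j.
  rewrite /triple_term /Q exprMn.
  rewrite mulrAC -exprD; congr (x ^+ _ * y ^+ _).
    by rewrite /= binS bin1 addnC; lia.
  case: j => [|j]; first by rewrite sub0r.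
  by rewrite (_ : j.+1%:Z - 1 = j) //; lia.
have H z : qpoch (- z) Q r = \sum_(j < r.+1) qbinom Q r j * Q ^+ 'C(j, 2) * z ^+ j.
  elim: r z => [|r IH] z.
    by rewrite qpoch0 big_ord1 /= !mulr1.
  rewrite qpochSl mulNr IH [in RHS]big_ord_recl /= opprK mulrDl mul1r.
  rewrite [in RHS](eq_bigr (fun i : 'I_r.+1 =>
     z * (qbinom Q r i * Q ^+ 'C(i, 2) * (z * Q) ^+ i) +
     qbinom Q r i.+1 * Q ^+ 'C(i.+1, 2) * (z * Q) ^+ i.+1)); last first.
    move=> i _; rewrite /bump add1n /= binS bin1 !exprMn !exprD !exprS; ring.
  rewrite big_split /= -mulr_sumr [in RHS]addrCA addrC; congr (_ + _).
  rewrite [in LHS]big_ord_recl [in RHS]big_ord_recr /= (@qbinom_gt Q r r.+1) // !mul0r addr0.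
  by rewrite qbinom0 !expr0.
by rewrite H; apply: eq_bigr => j _; rewrite jE mulrA.
Qed.

(** Writing the base as x y lets the product be built factor by factor in any
    commutative ring: no inverse of x or y occurs, as it would in the classical
    form with z and its inverse. *)
Lemma finite_triple x y r s :
  qpoch (- x) (x * y) r * qpoch (- y) (x * y) s =
  \sum_(j < (r + s).+1) qbinom (x * y) (r + s) j * triple_term x y (j%:Z - s%:Z).
Proof.
elim: s => [|s IH].
  rewrite qpoch0 mulr1 addn0 finite_triple_right.
  by apply: eq_bigr => j _; rewrite subr0.
rewrite qpochS mulrA IH addnS [in RHS]big_ord_recl /=.
rewrite [in RHS](eq_bigr (fun i : 'I_(r + s).+1 =>
    qbinom (x * y) (r + s) i * triple_term x y (i%:Z - s%:Z) +
    qbinom (x * y) (r + s) i.+1 * triple_term x y (i.+1%:Z - s%:Z) * (y * (x * y) ^+ s)));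
  last first.
  move=> i _; rewrite /bump add1n /= mulrDl.
  congr (_ * triple_term _ _ _ + _); first lia.
  transitivity (qbinom (x * y) (r + s) i.+1 *
    (triple_term x y (i.+1%:Z - s.+1%:Z) * (x * y) ^+ i.+1)); first by ring.
  by rewrite triple_term_shift; ring.
rewrite big_split /= mulNr opprK mulrDr mulr1 addrCA; congr (_ + _).
rewrite -mulr_suml [in LHS]big_ord_recl [in RHS]big_ord_recr /=.
rewrite (@qbinom_gt _ (r + s) (r + s).+1) // !mul0r addr0 mulrDl; congr (_ + _).
have := triple_term_shift x y s 0; rewrite expr0 mulr1 => ->.
by rewrite qbinom0 !mul1r mulrA.
Qed.

End FiniteProducts.

(** * Infinite products at a nilpotent element *)

(** The inverse of [qpoch x Q n] when the n-th power of x vanishes. *)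
Definition geom {R : comNzRingType} (x Q : R) (n : nat) : R :=
  \prod_(i < n) \sum_(j < n) (x * Q ^+ i) ^+ j.

Definition int_range (n : nat) : seq int :=
  [seq j%:Z - n%:Z | j <- iota 0 n.*2.+1].

Lemma mem_int_range n k : (k \in int_range n) = (`|k| <= n)%N.
Proof.
apply/mapP/idP => [[j]|le_kn]; first by rewrite mem_iota => /andP[_ j_le] ->; lia.
by exists (absz (k + n%:Z)); rewrite ?mem_iota; lia.
Qed.

Lemma int_range_uniq n : uniq (int_range n).
Proof. by rewrite map_inj_uniq ?iota_uniq // => i j /addIr[]. Qed.

Section Nilpotent.
Variables (A : comNzRingType) (q : A) (M : nat).
Hypothesis qM0 : q ^+ M = 0.

Lemma expr_nil n : (M <= n)%N -> q ^+ n = 0.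
Proof. by move=> /subnKC <-; rewrite exprD qM0 mul0r. Qed.

(** The infinite product (c q^a; q^d): for d > 0 all factors of index at
    least M are 1. *)
Definition qinf (c : A) (a d : nat) : A := qpoch (c * q ^+ a) (q ^+ d) M.

(** The factors of index m and more are 1 modulo q^(a + d m), so that they become
    equal to 1 after multiplication by q^e. *)
Lemma qpoch_stable c a d e m n : (0 < d)%N -> (m <= n)%N -> (M <= e + m)%N ->
  q ^+ e * qpoch (c * q ^+ a) (q ^+ d) n = q ^+ e * qpoch (c * q ^+ a) (q ^+ d) m.
Proof.
move=> d0 /subnKC <- le_M; elim: (n - m)%N => [|k IH]; first by rewrite addn0.
rewrite addnS qpochS mulrA IH mulrBr mulr1 -exprM.
rewrite [X in _ - X](_ : _ = q ^+ (e + a + d * (m + k)) *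
  (qpoch (c * q ^+ a) (q ^+ d) m * c)); last by rewrite !exprD; ring.
rewrite (@expr_nil (e + a + d * (m + k))) ?mul0r ?subr0 //.
have := leq_pmull (m + k) d0; lia.
Qed.

Lemma qinfE c a d n : (0 < d)%N -> (M <= n)%N ->
  qpoch (c * q ^+ a) (q ^+ d) n = qinf c a d.
Proof.
by move=> d0 le_Mn; have := @qpoch_stable c a d 0 M n d0 le_Mn (leqnn M); rewrite !mul1r.
Qed.

Lemma qinf_split c a d k : (0 < d)%N -> (0 < k)%N ->
  qinf c a d = \prod_(i < k) qinf c (a + i * d) (k * d).
Proof.
move=> d0 k0; rewrite -(@qinfE c a d (k * M)) ?leq_pmull // qpoch_split.
by apply: eq_bigr => i _; rewrite /qinf -mulrA -!exprM -exprD (mulnC d i) (mulnC d k).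
Qed.

(** From (1 - t) (1 + t) = 1 - t^2 in each factor. *)
Lemma qinf_pm a d : qinf 1 a d * qinf (-1) a d = qinf 1 (2 * a) (2 * d).
Proof.
rewrite /qinf mulN1r mul1r qpoch_pm -!exprM mul1r.
by rewrite mulnC (mulnC d).
Qed.

Lemma qinf_geom a d : (0 < a)%N -> qinf 1 a d * geom (q ^+ a) (q ^+ d) M = 1.
Proof.
move=> a0; rewrite /qinf mul1r /qpoch /geom -big_split big1 //= => i _.
set t := q ^+ a * _; rewrite -(opprB t 1) mulNr -subrX1 opprB.
by rewrite /t -exprM -exprD -exprM expr_nil ?subr0 //; nia.
Qed.

Lemma qinf_cancel a d x y : (0 < a)%N -> qinf 1 a d * x = qinf 1 a d * y -> x = y.
Proof.
move=> a0 /(congr1 ( *%R (geom (q ^+ a) (q ^+ d) M))).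
by rewrite !mulrA [geom _ _ _ * _]mulrC qinf_geom // !mul1r.
Qed.

(** The exponent of q in [triple_term] at x = q^a and y = q^b. *)
Definition theta_exp (a b : nat) (k : int) : nat := a * tri k + b * tri (k - 1).

(** The exponent is at least k^2; this makes truncated theta series agree with the
    full ones. *)
Lemma theta_exp_ge a b k : (0 < a)%N -> (0 < b)%N -> (`|k| <= theta_exp a b k)%N.
Proof.
move=> a0 b0; have := triE k; have := triE (k - 1) => H1 H2.
have : (`|k| <= tri k + tri (k - 1))%N by nia.
by move=> /leq_trans; apply; rewrite /theta_exp leq_add // leq_pmull.
Qed.

(** When c^2 = 1 this is f(c q^a, c q^b), because tri k + tri (k - 1) = k^2 has the
    parity of k. *)
Definition theta_sum (c : A) (a b n : nat) : A :=
  \sum_(k <- int_range n) c ^+ `|k| * q ^+ theta_exp a b k.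

(** Pass to the limit in [finite_triple] with n factors on each side.  There the
    k-th term carries the Gaussian binomial 2 n over n + k, which tends to the
    inverse of (Q; Q) with Q = q^(a + b).  The limit is already attained: the term
    is divisible by q^|k|, and modulo q^(M - |k|) each of the three q-factorials in
    [qbinom_qpoch] equals (Q; Q). *)
Lemma jacobi_triple (c : A) a b n : c * c = 1 ->
  (0 < a)%N -> (0 < b)%N -> (M <= n)%N ->
  theta_sum c a b n = qinf (- c) a (a + b) * qinf (- c) b (a + b) * qinf 1 (a + b) (a + b).
Proof.
move=> cc a0 b0 le_Mn.
set x := c * q ^+ a; set y := c * q ^+ b.
have xyQ : x * y = q ^+ (a + b).
  by rewrite exprD /x /y mulrACA cc mul1r.
have ab0 : (0 < a + b)%N by rewrite addn_gt0 a0.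
set E := qinf 1 (a + b) (a + b).
have EE m e : (M <= e + m)%N -> q ^+ e * qpoch (q ^+ (a + b)) (q ^+ (a + b)) m = q ^+ e * E.
  move=> le_M; rewrite -[X in qpoch X]mul1r /E.
  case: (leqP m M) => [le_mM | /ltnW le_mM].
    by rewrite /qinf [in RHS](@qpoch_stable _ _ _ _ m).
  by rewrite (@qpoch_stable _ _ _ _ M) //; lia.
have cexp (i j : nat) : odd i = odd j -> c ^+ i = c ^+ j.
  move=> eq_ij; rewrite -(odd_double_half i) -(odd_double_half j) eq_ij !exprD.
  by rewrite -!mul2n !exprM !expr2 cc !expr1n.
have jE k : triple_term x y k = c ^+ `|k| * q ^+ theta_exp a b k.
  rewrite /triple_term /x /y !exprMn mulrACA -!exprM -!exprD; congr (_ * _).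
  apply: cexp; have := triE k; have := triE (k - 1) => H1 H2.
  have : (tri k + tri (k - 1) = `|k| * `|k|)%N by nia.
  by move=> ->; rewrite oddM andbb.
have := @finite_triple A x y n n; rewrite xyQ -!mulNr -/(qinf _ _ _).
rewrite !qinfE // => ->; rewrite mulr_suml addnn.
rewrite /theta_sum /int_range big_map -[in LHS](subn0 n.*2.+1) -/(index_iota _ _) big_mkord.
apply: eq_bigr => j _; set k : int := j%:Z - n%:Z.
have le_j := ltn_ord j.
(* The goal gets a second factor E, so that each of the two q-factorials in the
   denominator of the binomial can be exchanged for one. *)
apply: (@qinf_cancel (a + b) (a + b)) => //; rewrite -/E jE.
have tk := theta_exp_ge k a0 b0.
have H m : (M <= `|k| + m)%N -> q ^+ theta_exp a b k * E =
    q ^+ theta_exp a b k * qpoch (q ^+ (a + b)) (q ^+ (a + b)) m.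
  by move=> le_M; rewrite EE //; lia.
have [le1 le2] : (M <= `|k| + j)%N /\ (M <= `|k| + (n.*2 - j))%N by rewrite /k; lia.
have le3 : (M <= `|k| + n.*2)%N by lia.
rewrite [RHS](_ : _ = qbinom (q ^+ (a + b)) n.*2 j * c ^+ `|k| *
   (q ^+ theta_exp a b k * E) * E); last by ring.
rewrite (H _ le1).
rewrite [RHS](_ : _ = qbinom (q ^+ (a + b)) n.*2 j * qpoch (q ^+ (a + b)) (q ^+ (a + b)) j
   * c ^+ `|k| * (q ^+ theta_exp a b k * E)); last by ring.
rewrite (H _ le2).
rewrite [LHS](_ : _ = c ^+ `|k| * (q ^+ theta_exp a b k * E)); last by ring.
rewrite (H _ le3) -(@qbinom_qpoch _ _ n.*2 j) //; ring.
Qed.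

End Nilpotent.

(** * Weighted enumeration by size *)

(** A finite list standing for the set P in generating functions truncated at q^M.
    Elements of size M or more may be present, as they contribute 0; this slack
    makes the notion stable under products and words without any filtering. *)
Definition exhausts {K : eqType} (P : pred K) (sz : K -> nat) (M : nat) (s : seq K) :=
  [/\ uniq s, {in s, forall x, P x} & forall x, P x -> (sz x < M)%N -> x \in s].

Fixpoint words {K : Type} (s : seq K) (n : nat) : seq (seq K) :=
  if n is m.+1 then [::] :: [seq x :: l | x <- s, l <- words s m] else [:: [::]].

Lemma mem_words (K : eqType) (s : seq K) n l :
  (l \in words s n) = all (mem s) l && (size l <= n)%N.
Proof.
elim: n l => [|n IH] [|x l] //=; first by rewrite inE andbF.
rewrite inE /= ltnS -andbA -IH.
apply/allpairsP/andP => [[[y l'] /= [sy wl' [-> ->]]] //|[sx wl]].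
by exists (x, l).
Qed.

Lemma words_uniq (K : eqType) (s : seq K) n : uniq s -> uniq (words s n).
Proof.
move=> us; elim: n => //= n IH; apply/andP; split.
  by apply/allpairsP => -[[x l] [_ _]].
by apply: allpairs_uniq => // -[x l] [y l'] _ _ [-> ->].
Qed.

Lemma exhausts_pair (K L : eqType) (P : pred K) (P' : pred L) sz sz' M s t :
  exhausts P sz M s -> exhausts P' sz' M t ->
  exhausts [pred p | P p.1 && P' p.2] (fun p => sz p.1 + sz' p.2)%N M
    [seq (x, y) | x <- s, y <- t].
Proof.
move=> [us sP cs] [ut tP ct]; split.
- by apply: allpairs_uniq => // -[x y] [x' y'].
- by move=> p /allpairsP[[x y] /= [sx ty ->]] /=; rewrite sP ?tP.
- move=> [x y] /= /andP[Px Py] lt_M; apply/allpairsP; exists (x, y).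
  by split => //=; [apply: cs | apply: ct] => //; lia.
Qed.

(** Letters have positive size, so a word of size less than M has length less
    than M. *)
Lemma exhausts_words (K : eqType) (P : pred K) sz M s :
  (forall x, P x -> (0 < sz x)%N) -> exhausts P sz M s ->
  exhausts (all P) (fun l => \sum_(x <- l) sz x)%N M (words s M).
Proof.
move=> sz0 [us sP cs]; split; first exact: words_uniq.
  move=> l; rewrite mem_words => /andP[/allP sl _].
  by apply/allP => x /sl; apply: sP.
move=> l /allP Pl lt_M; rewrite mem_words; apply/andP; split.
  apply/allP => x lx; apply: cs; first exact: Pl.
  by apply: leq_ltn_trans lt_M; rewrite (big_rem x) //= leq_addr.
apply: leq_trans (ltnW lt_M); rewrite -sum1_size !big_seq.
by apply: leq_sum => x lx; apply/sz0/Pl.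
Qed.

Lemma exhausts_map (K L : eqType) (g : K -> L) (P : pred K) (P' : pred L) sz sz' M s :
  injective g -> (forall x, P' (g x) = P x) -> (forall y, P' y -> exists x, g x = y) ->
  (forall x, sz' (g x) = sz x) ->
  exhausts P sz M s -> exhausts P' sz' M [seq g x | x <- s].
Proof.
move=> inj_g P'g surj_g sz'g [us sP cs]; split.
- by rewrite map_inj_uniq.
- by move=> y /mapP[x sx ->]; rewrite P'g sP.
- move=> y P'y; have [x eq_y] := surj_g y P'y; move: P'y; rewrite -eq_y P'g sz'g.
  by move=> Px lt_M; rewrite map_f ?cs.
Qed.

Lemma exhausts_int_range sz M n :
  (forall k, `|k| <= sz k)%N -> (M <= n)%N -> exhausts predT sz M (int_range n).
Proof.
move=> sz_ge le_Mn; split => [|//|k _ lt_M]; first exact: int_range_uniq.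
by rewrite mem_int_range; have := sz_ge k; lia.
Qed.

Section GeneratingFunctions.
Variables (A : comNzRingType) (q : A) (M : nat).
Hypothesis qM0 : q ^+ M = 0.

Definition gf {K : Type} (sz : K -> nat) (wt : K -> A) (s : seq K) : A :=
  \sum_(x <- s) wt x * q ^+ sz x.

(** The generating function depends on the set only, so two enumerations of the same
    set give an identity of series; this is how theta series are reindexed. *)
Lemma gf_exhausts (K : eqType) (P : pred K) sz wt s t :
  exhausts P sz M s -> exhausts P sz M t -> gf sz wt s = gf sz wt t.
Proof.
move=> [us sP cs] [ut tP ct].
have H r : gf sz wt r = gf sz wt [seq x <- r | (sz x < M)%N].
  rewrite /gf big_filter [LHS](bigID (fun x => sz x < M)%N) /= [X in _ + X]big1 ?addr0 //.
  by move=> x; rewrite -leqNgt => /(expr_nil qM0) ->; rewrite mulr0.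
rewrite H [RHS]H; apply/perm_big/uniq_perm; rewrite ?filter_uniq // => x.
rewrite !mem_filter; case: ltnP => //= lt_M.
by apply/idP/idP => [/sP|/tP] Px; [apply: ct | apply: cs].
Qed.

Lemma gf_pair (K L : Type) sz sz' wt wt' (s : seq K) (t : seq L) :
  gf (fun p => sz p.1 + sz' p.2)%N (fun p => wt p.1 * wt' p.2)
    [seq (x, y) | x <- s, y <- t] = gf sz wt s * gf sz' wt' t.
Proof.
rewrite /gf big_allpairs_dep mulr_suml; apply: eq_bigr => x _.
rewrite mulr_sumr; apply: eq_bigr => y _ /=.
by rewrite exprD mulrACA.
Qed.

(** The words of length i contribute X^i, where X is the generating function of the
    letters; X is a multiple of q, so the geometric series stops at X^M. *)
Lemma gf_words (K : eqType) sz wt (s : seq K) :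
  {in s, forall x, 0 < sz x}%N ->
  gf (fun l => \sum_(x <- l) sz x)%N (fun l => \prod_(x <- l) wt x) (words s M)
    * (1 - gf sz wt s) = 1.
Proof.
move=> sz0; set X := gf sz wt s.
have XM : X ^+ M.+1 = 0.
  rewrite /X /gf big_seq (eq_bigr (fun x => q * (wt x * q ^+ (sz x).-1))); last first.
    by move=> x sx; rewrite mulrCA -exprS prednK // sz0.
  by rewrite -mulr_sumr exprMn exprS qM0 mulr0 mul0r.
have -> : gf (fun l => \sum_(x <- l) sz x)%N (fun l => \prod_(x <- l) wt x) (words s M)
    = \sum_(i < M.+1) X ^+ i.
  elim: {XM} M => [|n IH].
    by rewrite /gf big_seq1 big_ord1 !big_nil mulr1.
  rewrite /gf [words _ _]/= big_cons !big_nil mulr1 big_ord_recl; congr (_ + _).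
  under [RHS]eq_bigr => i _ do rewrite lift0 exprS.
  rewrite -mulr_sumr -IH /X /gf big_allpairs_dep mulr_suml; apply: eq_bigr => x _.
  rewrite mulr_sumr; apply: eq_bigr => l _.
  by rewrite !big_cons exprD mulrACA.
by rewrite mulrC -opprB mulNr -subrX1 XM sub0r opprK.
Qed.

End GeneratingFunctions.

(** * Theta series as products *)
Lemma eqn_doublez (i j : nat) : i%:Z * 2 = j%:Z * 2 -> i = j.
Proof. lia. Qed.

Lemma theta_expE a b k :
  (theta_exp a b k)%:Z * 2 = a%:Z * (k * (k + 1)) + b%:Z * (k * (k - 1)).
Proof. by rewrite /theta_exp PoszD !PoszM mulrDl -!mulrA !triE; ring. Qed.

Section Identities.
Variables (A : comNzRingType) (q : A) (M : nat).
Hypothesis qM0 : q ^+ M = 0.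
Local Notation theta c a b := (theta_sum q c a b M).
Local Notation gf := (gf q).

Lemma theta_gf c a b :
  theta c a b = gf (theta_exp a b) (fun k => c ^+ `|k|) (int_range M).
Proof. by []. Qed.

Lemma theta_exhausts a b : (0 < a)%N -> (0 < b)%N ->
  exhausts predT (theta_exp a b) M (int_range M).
Proof. by move=> a0 b0; apply: exhausts_int_range => // k; apply: theta_exp_ge. Qed.

(** The even indices 2 k and the odd indices 2 k + 1 of the series for psi(-q) give
    two theta series in q^2, because 2 k^2 - k has the parity of k. *)
Lemma theta_dissection :
  theta (-1) 1 3 = theta 1 6 10 - q * theta 1 14 2.
Proof.
have ev k : theta_exp 1 3 (2 * k) = theta_exp 6 10 k.
  by apply: eqn_doublez; rewrite !theta_expE; ring.
have od k : theta_exp 1 3 (2 * k + 1) = (theta_exp 14 2 k).+1.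
  by apply: eqn_doublez; rewrite -(addn1 (theta_exp _ _ _)) PoszD [RHS]mulrDl !theta_expE; ring.
have ex : exhausts predT (theta_exp 1 3) M
    ([seq 2 * k | k <- int_range M] ++ [seq 2 * k + 1 | k <- int_range M]).
  split => //.
    rewrite cat_uniq; apply/and3P; split.
    - by rewrite map_inj_uniq ?int_range_uniq // => k l; lia.
    - by apply/hasPn => _ /mapP[k _ ->]; apply/mapP => -[l _]; lia.
    - by rewrite map_inj_uniq ?int_range_uniq // => k l; lia.
  move=> k _ lt_M; rewrite mem_cat; apply/orP.
  have := @theta_exp_ge 1 3 k isT isT => le_k.
  have [[l ek]|[l ek]] : (exists l, k = 2 * l) \/ (exists l, k = 2 * l + 1).
  - have := divz_eq k 2; have := modz_ge0 k (isT : 2 != 0 :> int).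
    have := ltz_pmod k (isT : 0 < 2 :> int).
    move=> h1 h2 h3; have [e|e] : (k %% 2)%Z = 0 \/ (k %% 2)%Z = 1 by lia.
      by left; exists (k %/ 2)%Z; lia.
    by right; exists (k %/ 2)%Z; lia.
  - by left; apply/mapP; exists l; rewrite // mem_int_range; lia.
  - by right; apply/mapP; exists l; rewrite // mem_int_range; lia.
rewrite theta_gf (gf_exhausts qM0 _ (@theta_exhausts 1 3 isT isT) ex).
rewrite /gf /theta_sum big_cat !big_map /= mulr_sumr -sumrN; congr (_ + _).
  by apply: eq_bigr => k _; rewrite ev expr1n abszM exprM sqrrN !expr1n.
apply: eq_bigr => k _; rewrite od expr1n exprS mul1r.
rewrite (_ : (-1) ^+ _ = -1) ?mulN1r //.
by rewrite -signr_odd (_ : odd _ = true) //; lia.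
Qed.

(** The integer k is sent to 2 k - 1 or -2 k, according to its sign.  This bijection
    to the naturals turns 2 k^2 - k into a triangular number, hence the one-sided
    series psi into a bilateral theta series. *)
Definition tri_index (k : int) : nat :=
  match k with Posz 0 => 0 | Posz m.+1 => m.*2.+1 | Negz m => m.+1.*2 end.

Lemma triangularE m : (triangular m)%:Z * 2 = m%:Z * (m%:Z + 1).
Proof.
by rewrite /triangular divn2 -(triE m) /= -[m.+1]/(m.+1) mulnC -bin2.
Qed.

Lemma triangular_tri_index k : triangular (tri_index k) = theta_exp 1 3 k.
Proof.
apply: eqn_doublez; rewrite triangularE theta_expE.
case: k => [[|m]|m] //=; last rewrite NegzE; rewrite -?addnn ?PoszD; lia.
Qed.

Lemma theta_triangular :
  theta 1 1 3 = 1 + gf triangular (fun=> 1) (iota 1 M).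
Proof.
have inj : injective tri_index by move=> [[|i]|i] [[|j]|j] //=; lia.
have ex : exhausts predT triangular M (map tri_index (int_range M)).
  apply: (@exhausts_map _ _ _ predT predT (theta_exp 1 3)) => //.
  - move=> m _; exists (if odd m then (m./2.+1)%:Z else - (m./2)%:Z).
    by rewrite -[RHS]odd_double_half; case: odd => //; case: m./2.
  - by move=> k; rewrite triangular_tri_index.
  - exact: theta_exhausts.
have ex' : exhausts predT triangular M (0 :: iota 1 M).
  split; [by have := iota_uniq 0 M.+1|by []|move=> m _ lt_M].
  have : (m < M.+1)%N by have := triangularE m; nia.
  by rewrite -[0%N :: _]/(iota 0 M.+1) mem_iota.
transitivity (gf triangular (fun=> 1) (0%N :: iota 1 M)).
  rewrite -(gf_exhausts qM0 _ ex ex') /gf big_map.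
  by apply: eq_bigr => k _; rewrite expr1n triangular_tri_index.
by rewrite /gf big_cons mulr1.
Qed.

Lemma pentagonalE k : absz (pentagonal k) = theta_exp 1 2 k.
Proof.
rewrite /pentagonal (_ : _ - _ = (theta_exp 1 2 k)%:Z * 2) ?mulzK //.
by rewrite theta_expE; ring.
Qed.

Lemma pentagonal_ge0 k : 0 <= pentagonal k.
Proof.
rewrite /pentagonal (_ : _ - _ = (theta_exp 1 2 k)%:Z * 2) ?mulzK //.
by rewrite theta_expE; ring.
Qed.

Lemma theta_pentagonal :
  theta (-1) 1 2 = 1 + gf (fun k => absz (pentagonal k)) (fun k => (-1) ^+ `|k|)
     [seq k <- int_range M | k != 0].
Proof.
rewrite /theta_sum (bigD1_seq 0) ?int_range_uniq ?mem_int_range //.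
congr (_ + _); first by rewrite expr0 mul1r.
by rewrite /gf big_filter; apply: eq_bigr => k _; rewrite pentagonalE.
Qed.

Local Notation m a d := (qinf q M 1 a d).
Local Notation p a d := (qinf q M (-1) a d).

Lemma m_split2 a d : (0 < d)%N -> m a d = m a (2 * d) * m (a + d) (2 * d).
Proof.
move=> d0; rewrite (@qinf_split _ _ _ qM0 1 a d 2) // !big_ord_recl big_ord0 mulr1.
by rewrite mul0n mul1n addn0.
Qed.

Lemma m_split3 a d : (0 < d)%N ->
  m a d = m a (3 * d) * m (a + d) (3 * d) * m (a + 2 * d) (3 * d).
Proof.
move=> d0; rewrite (@qinf_split _ _ _ qM0 1 a d 3) // !big_ord_recl big_ord0 mulr1.
by rewrite mul0n mul1n addn0 mulrA.
Qed.

Let sqr1 : 1 * 1 = 1 :> A. Proof. exact: mulr1. Qed.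
Let sqrN1 : -1 * -1 = 1 :> A. Proof. by rewrite mulrNN mulr1. Qed.

Lemma phi_prod : theta (-1) 2 2 = m 2 4 ^+ 2 * m 4 4.
Proof. by rewrite (jacobi_triple qM0) // opprK. Qed.

Lemma psi_prod : theta 1 1 3 = p 1 4 * p 3 4 * m 4 4.
Proof. by rewrite (jacobi_triple qM0). Qed.

Lemma psi_neg_prod : theta (-1) 1 3 = m 1 4 * m 3 4 * m 4 4.
Proof. by rewrite (jacobi_triple qM0) // opprK. Qed.

Lemma euler_prod : theta (-1) 1 2 = m 1 1.
Proof. by rewrite (jacobi_triple qM0) // opprK (@m_split3 1 1). Qed.

Lemma m_2_4 : m 2 4 = m 2 8 * m 6 8.
Proof. exact: m_split2. Qed.

(** Gauss and Euler products for the three series; everything but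
    (q; q^4) (q^3; q^4) (q^2; q^4)^3 cancels because the product of (q; q^4) (q^3; q^4)
    with (-q; q^4) (-q^3; q^4) is (q^2; q^8) (q^6; q^8) = (q^2; q^4). *)
Lemma theta_quotient_prod U V : U * theta 1 1 3 = 1 -> V * theta (-1) 1 2 = 1 ->
  theta (-1) 2 2 ^+ 3 * U ^+ 2 * V = m 1 4 * m 3 4 * m 2 4 ^+ 3.
Proof.
rewrite phi_prod psi_prod euler_prod.
have -> : m 1 1 = m 1 4 * m 3 4 * (m 2 4 * m 4 4).
  by rewrite (@m_split2 1 1) // (@m_split2 1 2) // (@m_split2 2 2).
have e1 : m 1 4 * p 1 4 = m 2 8 by exact: qinf_pm.
have e3 : m 3 4 * p 3 4 = m 6 8 by exact: qinf_pm.
move=> HU HV.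
transitivity (m 1 4 * m 3 4 * m 2 4 ^+ 3 * (U * (p 1 4 * p 3 4 * m 4 4)) ^+ 2
   * (V * (m 1 4 * m 3 4 * (m 2 4 * m 4 4)))); last first.
  by rewrite HU HV expr1n !mulr1.
transitivity (U ^+ 2 * V * m 2 4 ^+ 4 * m 4 4 ^+ 3 * (m 1 4 * p 1 4 * (m 3 4 * p 3 4)) ^+ 2).
  by rewrite e1 e3 -m_2_4; ring.
ring.
Qed.

Local Notation g a d := (geom (q ^+ a) (q ^+ d) M).

Lemma m_2_4_16 : m 2 4 = m 2 16 * m 6 16 * m 10 16 * m 14 16.
Proof.
have := @m_split2 2 8 isT; have := @m_split2 6 8 isT.
rewrite m_2_4 => -> ->.
rewrite -[(2 * 8)%N]/16%N -[(2 + 8)%N]/10%N -[(6 + 8)%N]/14%N; ring.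
Qed.

Lemma m_4_4_32 : m 4 4 = m 4 32 * m 8 32 * m 12 32 * m 16 32 * m 20 32 * m 24 32 * m 28 32
  * m 32 32.
Proof.
rewrite (@m_split2 4 4) // (@m_split2 4 8) // (@m_split2 8 8) //.
rewrite (@m_split2 4 16) // (@m_split2 12 16) // (@m_split2 8 16) // (@m_split2 16 16) //.
rewrite -[(2 * 16)%N]/32%N -[(4 + 16)%N]/20%N -[(12 + 16)%N]/28%N.
rewrite -[(8 + 16)%N]/24%N -[(16 + 16)%N]/32%N.
ring.
Qed.

Lemma m_16_16 : m 16 16 = m 16 32 * m 32 32.
Proof. exact: m_split2. Qed.

(** The triple product for f(q^6, q^10) has the factors (-q^6; q^16) (-q^10; q^16).
    Splitting one copy of (q^2; q^4) modulo 16 provides (q^6; q^16) (q^10; q^16),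
    and the product of these four is (q^12; q^32) (q^20; q^32).  Together with
    (q^16; q^16) it cancels half of the factors of J_4 = (q^4; q^4) modulo 32. *)
Lemma even_part : m 2 4 ^+ 3 * theta 1 6 10 =
  m 4 4 * (m 2 16 * m 14 16 * m 2 4 ^+ 2 * (g 4 32 * g 8 32 * g 24 32 * g 28 32)).
Proof.
rewrite (jacobi_triple qM0) // -[(6 + 10)%N]/16%N m_16_16 exprS {1}m_2_4_16.
have e6 : m 6 16 * p 6 16 = m 12 32 by exact: qinf_pm.
have e10 : m 10 16 * p 10 16 = m 20 32 by exact: qinf_pm.
transitivity (m 2 16 * m 14 16 * m 2 4 ^+ 2 * (m 6 16 * p 6 16) * (m 10 16 * p 10 16)
   * m 16 32 * m 32 32); first by ring.
rewrite e6 e10 m_4_4_32.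
transitivity (m 2 16 * m 14 16 * m 2 4 ^+ 2 * m 12 32 * m 20 32 * m 16 32 * m 32 32
  * (m 4 32 * g 4 32) * (m 8 32 * g 8 32) * (m 24 32 * g 24 32) * (m 28 32 * g 28 32));
  last by ring.
by rewrite !(qinf_geom qM0) // !mulr1.
Qed.

(** The same with (q^2; q^16) (q^14; q^16) in place of (q^6; q^16) (q^10; q^16). *)
Lemma odd_part : m 2 4 ^+ 3 * theta 1 14 2 =
  m 4 4 * (m 6 16 * m 10 16 * m 2 4 ^+ 2 * (g 8 32 * g 12 32 * g 20 32 * g 24 32)).
Proof.
rewrite (jacobi_triple qM0) // -[(14 + 2)%N]/16%N m_16_16 exprS {1}m_2_4_16.
have e2 : m 2 16 * p 2 16 = m 4 32 by exact: qinf_pm.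
have e14 : m 14 16 * p 14 16 = m 28 32 by exact: qinf_pm.
transitivity (m 6 16 * m 10 16 * m 2 4 ^+ 2 * (m 2 16 * p 2 16) * (m 14 16 * p 14 16)
   * m 16 32 * m 32 32); first by ring.
rewrite e2 e14 m_4_4_32.
transitivity (m 6 16 * m 10 16 * m 2 4 ^+ 2 * m 4 32 * m 28 32 * m 16 32 * m 32 32
  * (m 8 32 * g 8 32) * (m 12 32 * g 12 32) * (m 20 32 * g 20 32) * (m 24 32 * g 24 32));
  last by ring.
by rewrite !(qinf_geom qM0) // !mulr1.
Qed.

(** Multiply by J_4 to recognise psi(-q), split it, and divide again. *)
Lemma theta_quotient_dissection U V : U * theta 1 1 3 = 1 -> V * theta (-1) 1 2 = 1 ->
  theta (-1) 2 2 ^+ 3 * U ^+ 2 * V =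
  m 2 16 * m 14 16 * m 2 4 ^+ 2 * (g 4 32 * g 8 32 * g 24 32 * g 28 32) -
  q * (m 6 16 * m 10 16 * m 2 4 ^+ 2 * (g 8 32 * g 12 32 * g 20 32 * g 24 32)).
Proof.
move=> HU HV; rewrite (theta_quotient_prod HU HV).
apply: (@qinf_cancel _ _ _ qM0 4 4) => //.
transitivity (m 2 4 ^+ 3 * theta (-1) 1 3); first by rewrite psi_neg_prod; ring.
by rewrite theta_dissection mulrBr mulrCA even_part odd_part; ring.
Qed.

End Identities.

(** * The two positive series *)
Lemma coef_comp_polyNX (p : {poly int}) i : (p \Po (- 'X))`_i = (-1) ^+ i * p`_i.
Proof.
rewrite coef_comp_poly; case: (ltnP i (size p)) => [lt_i|le_i].
  rewrite (bigD1 (Ordinal lt_i)) //= -scaleN1r exprZn coefZ coefXn eqxx mulr1.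
  rewrite big1 ?addr0 1?mulrC // => j; rewrite -val_eqE /= => ne_ji.
  by rewrite exprZn coefZ coefXn eq_sym (negPf ne_ji) !mulr0.
rewrite [in RHS]nth_default // mulr0 big1 // => j _.
rewrite -scaleN1r exprZn coefZ coefXn.
by rewrite gtn_eqF ?mulr0 // (leq_trans (ltn_ord j)).
Qed.

(** Composing with -X^2 puts the coefficients of e, with alternating signs, at the
    even places; those of o go to the odd places. *)
Lemma coef_dissection (e o : {poly int}) m :
  ((e \Po (- 'X^2)) - 'X * (o \Po (- 'X^2)))`_m =
  (if odd m then - (-1) ^+ m./2 * o`_m./2 else (-1) ^+ m./2 * e`_m./2).
Proof.
have H (p : {poly int}) i :
    (p \Po (- 'X^2))`_i = if odd i then 0 else (-1) ^+ i./2 * p`_i./2.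
  have -> : - 'X^2 = (- 'X) \Po 'X^2 :> {poly int} by rewrite rmorphN /= comp_polyX.
  by rewrite comp_polyA coef_comp_poly_Xn // dvdn2 divn2 coef_comp_polyNX; case: odd.
rewrite coefB coefXM !H; case: m => [|m] /=; first by rewrite subr0.
by rewrite uphalf_half; case: (odd m); rewrite /= ?subr0 ?sub0r ?mulNr.
Qed.

Lemma rmorph_qpoch (R S : comNzRingType) (f : {rmorphism R -> S}) x Q n :
  f (qpoch x Q n) = qpoch (f x) (f Q) n.
Proof.
rewrite rmorph_prod; apply: eq_bigr => i _.
by rewrite rmorphB rmorph1 rmorphM rmorphXn.
Qed.

Lemma rmorph_geom (R S : comNzRingType) (f : {rmorphism R -> S}) x Q n :
  f (geom x Q n) = geom (f x) (f Q) n.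
Proof.
rewrite rmorph_prod; apply: eq_bigr => i _.
rewrite rmorph_sum; apply: eq_bigr => j _.
by rewrite rmorphXn rmorphM rmorphXn.
Qed.

Section Positivity.
Variable M : nat.
Hypothesis M_gt0 : (0 < M)%N.

(** In degrees below M these count the partitions into parts a, a + d, a + 2 d and
    so on, without and with repetition. *)
Definition distinct a d : {poly int} := qpoch (- 'X^a) ('X^d) M.
Definition parts a d : {poly int} := geom ('X^a) ('X^d) M.

Definition even_series : {poly int} :=
  distinct 1 8 * distinct 7 8 * distinct 1 2 ^+ 2 *
  (parts 2 16 * parts 4 16 * parts 12 16 * parts 14 16).

Definition odd_series : {poly int} :=
  distinct 3 8 * distinct 5 8 * distinct 1 2 ^+ 2 *
  (parts 4 16 * parts 6 16 * parts 10 16 * parts 12 16).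

Local Notation nonneg p := ((p : {poly int}) \is a polyOver (@Num.Def.nneg_num_pred int)).

(** Positivity propagates through products: if all factors are nonnegative, then one
    positive term in each factor suffices. *)
Lemma coefM_gt0 (p r : {poly int}) i j : nonneg p -> nonneg r ->
  0 < p`_i -> 0 < r`_j -> 0 < (p * r)`_(i + j).
Proof.
move=> /polyOverP p0 /polyOverP r0 pi rj.
have ii : (i < (i + j).+1)%N by lia.
rewrite coefM (bigD1 (Ordinal ii)) //= addKn ltr_wpDr ?mulr_gt0 //.
by apply: sumr_ge0 => k _; apply: mulr_ge0; [apply: p0 | apply: r0].
Qed.

Lemma distinct_factor a d i : nonneg (1 - - 'X^a * ('X^d) ^+ i).
Proof.
by rewrite mulNr opprK -exprM -exprD; apply: rpredD; [exact: rpred1 | exact: polyOverXn].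
Qed.

Lemma nonneg_distinct a d : nonneg (distinct a d).
Proof. by apply: rpred_prod => i _; apply: distinct_factor. Qed.

Lemma nonneg_parts a d : nonneg (parts a d).
Proof.
apply: rpred_prod => i _; apply: rpred_sum => j _.
by rewrite -exprM -exprD -exprM polyOverXn.
Qed.
Hint Resolve nonneg_distinct nonneg_parts : core.

Lemma prod_coef_gt0 (F : nat -> {poly int}) i :
  (forall j, nonneg (F j)) -> (forall j, 0 < (F j)`_0) -> 0 < (F 0%N)`_i ->
  0 < (\prod_(j < M) F j)`_i.
Proof.
move=> F0 F1 Fi; case: M M_gt0 => // m _; rewrite big_ord_recl -(addn0 i).
apply: coefM_gt0 => //; first by apply: rpred_prod.
elim/big_ind: _ => [|p r p0 r0|j _]; [by rewrite coef1| |exact: F1].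
by rewrite coefM big_ord1 mulr_gt0.
Qed.

Lemma distinct_coef0 a d : (0 < a)%N -> 0 < (distinct a d)`_0.
Proof.
move=> a0; apply: prod_coef_gt0 (distinct_factor a d) _ _ => [j|];
  by rewrite mulNr opprK -exprM -exprD coefD coef1 coefXn /=; case: eqP.
Qed.

Lemma distinct_coef a d : (0 < a)%N -> 0 < (distinct a d)`_a.
Proof.
move=> a0; apply: prod_coef_gt0 (distinct_factor a d) _ _ => [j|];
  rewrite mulNr opprK -exprM -exprD coefD coef1 coefXn /=; first by case: eqP.
by rewrite muln0 addn0 eqxx; case: eqP.
Qed.

Lemma parts_coef a d i : (0 < a)%N -> (i < M)%N -> 0 < (parts a d)`_(a * i).
Proof.
move=> a0 lt_iM; rewrite /parts /geom.
pose F (j : nat) : {poly int} := \sum_(k < M) ('X^a * 'X^d ^+ j) ^+ k.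
have FE j : F j = \sum_(k < M) 'X^((a + d * j) * k).
  by apply: eq_bigr => k _; rewrite -exprM -exprD -exprM.
have cF j k : (k < M)%N -> 0 < (F j)`_((a + d * j) * k).
  move=> lt_kM; rewrite FE coef_sum (bigD1 (Ordinal lt_kM)) //= coefXn eqxx.
  by rewrite ltr_pwDl // sumr_ge0 // => l _; rewrite coefXn.
apply: (@prod_coef_gt0 F) => [j|j|].
- by rewrite FE rpred_sum // => k _; rewrite polyOverXn.
- by have := cF j 0%N M_gt0; rewrite muln0.
- by have := cF 0%N i lt_iM; rewrite muln0 addn0.
Qed.

(** An even part of the exponent is taken from 1 / (1 - X^2) and a remaining 1 from
    1 + X. *)
Lemma even_series_gt0 i : (i < M)%N -> 0 < even_series`_i.
Proof.
move=> lt_iM; rewrite /even_series expr2.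
have -> : (i = 0 + 0 + (0 + (if odd i then 1 else 0)) + (2 * i./2 + 0 + 0 + 0))%N.
  by rewrite -[LHS]odd_double_half; case: odd; lia.
have c1 : 0 < (distinct 1 2)`_(if odd i then 1 else 0).
  by case: odd; [apply: distinct_coef | apply: distinct_coef0].
have c2 : 0 < (parts 2 16)`_(2 * i./2).
  by apply: parts_coef => //; lia.
have p0 a : (0 < a)%N -> 0 < (parts a 16)`_0.
  by move=> a0; have := parts_coef 16 a0 M_gt0; rewrite muln0.
by do !apply: coefM_gt0; rewrite ?rpredM // ?p0 // ?distinct_coef0.
Qed.

(** The multiple of 4 in the exponent is taken from 1 / (1 - X^4); the remainder 1 or
    2 comes from the two factors 1 + X, and 3 from 1 + X^3. *)
Lemma odd_series_gt0 i : (i < M)%N -> 0 < odd_series`_i.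
Proof.
move=> lt_iM; rewrite /odd_series expr2.
have [x [y [z [iE [x3 [y1 z1]]]]]] : exists x y z, (i = x + 0 + (y + z) + (4 * (i %/ 4) + 0 + 0 + 0)
   /\ (x = 0 \/ x = 3) /\ (y = 0 \/ y = 1) /\ (z = 0 \/ z = 1))%N.
  have : (i %% 4 < 4)%N by rewrite ltn_mod.
  have := divn_eq i 4; case: (i %% 4)%N => [|[|[|[|//]]]] iE _.
  - by exists 0%N, 0%N, 0%N; lia.
  - by exists 0%N, 0%N, 1%N; lia.
  - by exists 0%N, 1%N, 1%N; lia.
  - by exists 3%N, 0%N, 0%N; lia.
have cx : 0 < (distinct 3 8)`_x.
  by case: x3 => ->; [apply: distinct_coef0 | apply: distinct_coef].
have c1 j : (j = 0 \/ j = 1)%N -> 0 < (distinct 1 2)`_j.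
  by case=> ->; [apply: distinct_coef0 | apply: distinct_coef].
have c4 : 0 < (parts 4 16)`_(4 * (i %/ 4)).
  by apply: parts_coef => //; apply: leq_ltn_trans lt_iM; apply: leq_div.
have p0 a : (0 < a)%N -> 0 < (parts a 16)`_0.
  by move=> a0; have := parts_coef 16 a0 M_gt0; rewrite muln0.
by rewrite iE; do !apply: coefM_gt0; rewrite ?rpredM // ?p0 ?distinct_coef0 ?c1.
Qed.

End Positivity.

(** * The generating function of alpha *)
Section TruncatedSeries.
Variable M : nat.
Hypothesis M_gt0 : (0 < M)%N.

Definition trunc := {poly %/ ('X^M : {poly int})}.
Definition to_trunc : {rmorphism {poly int} -> trunc} := in_qpoly 'X^M.

Lemma to_trunc_coef p r i : (i < M)%N -> to_trunc p = to_trunc r -> p`_i = r`_i.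
Proof.
move=> lt_iM /(congr1 (fun t : trunc => (t : {poly int})`_i)) /=.
have hM : mk_monic 'X^M = 'X^M :> {poly int} by rewrite mk_monic_Xn prednK.
have H s : (Pdiv.Ring.rmodp s 'X^M)`_i = s`_i.
  rewrite [in RHS](Pdiv.RingMonic.rdivp_eq (monicXn _ M) s) coefD coefMXn lt_iM.
  by rewrite add0r.
by rewrite hM !H.
Qed.

Lemma to_truncX_nil : to_trunc 'X ^+ M = 0.
Proof.
have <- : to_trunc ('X^M) = to_trunc 'X ^+ M by exact: rmorphXn.
apply/val_eqP/eqP; rewrite /= mk_monic_Xn prednK //.
exact: Pdiv.RingMonic.rmodpp (monicXn _ M).
Qed.
End TruncatedSeries.

Definition valid (s : candidate) : bool :=
  let: (v, a, b, c) := s in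
  [&& all (fun x => 0 < x)%N a, all (fun x => 0 < x)%N b & all (fun x => x != 0) c].

Definition vec_size (v : {ffun 'I_3 -> int}) : nat := \sum_(j < 3) 2 * `|v j| ^ 2.
Definition tri_size (a : seq nat) : nat := \sum_(x <- a) triangular x.
Definition pent_size (c : seq int) : nat := \sum_(x <- c) `|pentagonal x|.

Definition size_of (s : candidate) : nat :=
  let: (v, a, b, c) := s in (vec_size v + tri_size a + tri_size b + pent_size c)%N.

Lemma is_solutionE n s : is_solution n s <-> valid s && (size_of s == n).
Proof.
case: s => [[[v a] b] c]; rewrite /is_solution /valid /size_of.
have sumZ (I : Type) (r : seq I) (F : I -> nat) :
    \sum_(i <- r) (F i)%:Z = (\sum_(i <- r) F i)%N%:Z.
  by rewrite (big_morph Posz PoszD erefl).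
have -> : 2 * (\sum_(j < 3) v j ^+ 2) = (vec_size v)%:Z.
  rewrite -sumZ mulr_sumr; apply: eq_bigr => j _.
  by rewrite PoszM -abszX gez0_abs // sqr_ge0.
have -> : \sum_(x <- c) pentagonal x = (pent_size c)%:Z.
  by rewrite -sumZ; apply: eq_bigr => x _; rewrite gez0_abs ?pentagonal_ge0.
rewrite !sumZ -!PoszD; split.
  move=> [/allP Ha /allP Hb /allP Hc [->]].
  by rewrite Ha Hb Hc eqxx.
by move=> /andP[/and3P[/allP Ha /allP Hb /allP Hc] /eqP <-].
Qed.

Definition vec_weight (A : comNzRingType) (v : {ffun 'I_3 -> int}) : A :=
  \prod_(j < 3) (-1) ^+ `|v j|.
Definition tri_weight (A : comNzRingType) (a : seq nat) : A := \prod_(x <- a) -1.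
Definition pent_weight (A : comNzRingType) (c : seq int) : A :=
  \prod_(x <- c) - (-1) ^+ `|x|.

(** The sign is multiplicative over all entries: each tuple entry contributes -1 for
    the length of its tuple. *)
Lemma weightE (A : comNzRingType) v a b c : (weight (v, a, b, c))%:~R =
  vec_weight A v * tri_weight A a * tri_weight A b * pent_weight A c.
Proof.
have signz (k : int) : (-1) ^ k = (-1) ^+ `|k| :> int.
  by case: k => // k; rewrite NegzE -exprz_inv.
have sum_sign (I : Type) (r : seq I) (F : I -> int) :
    (-1) ^ (\sum_(i <- r) F i) = \prod_(i <- r) (-1) ^+ `|F i| :> int.
  rewrite (big_morph (fun k => (-1 : int) ^ k) (id1 := 1) (op1 := *%R)) //.
    by apply: eq_bigr => i _; rewrite signz.
  by move=> k l; rewrite exprzDr ?unitrN1.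
have sign_size (T : Type) (r : seq T) : (-1) ^ (size r)%:Z = \prod_(x <- r) -1 :> int.
  by rewrite big_const_seq count_predT -exprnP; elim: size => //= n <-; rewrite exprS.
rewrite /weight !exprzDr ?unitrN1 // !sum_sign !sign_size -mulrA -big_split /=.
rewrite !rmorphM !rmorph_prod; congr (_ * _ * _ * _); apply: eq_bigr => x _.
- by rewrite rmorphXn rmorphN1.
- by rewrite mulN1r rmorphN rmorphXn rmorphN1.
Qed.

Definition vec_of (p : int * int * int) : {ffun 'I_3 -> int} :=
  [ffun j : 'I_3 => nth 0 [:: p.1.1; p.1.2; p.2] j].

Section Candidates.
Variable M : nat.

Definition vecs : seq {ffun 'I_3 -> int} :=
  [seq vec_of p | p <- [seq (p, z) | p <- [seq (x, y) | x <- int_range M, y <- int_range M],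
                                     z <- int_range M]].
Definition nonzero_range : seq int := [seq k <- int_range M | k != 0].

Definition candidates : seq candidate :=
  [seq (p, c) | p <- [seq (p, b) | p <- [seq (v, a) | v <- vecs, a <- words (iota 1 M) M],
                                   b <- words (iota 1 M) M],
                c <- words nonzero_range M].

Lemma vec_sizeE p :
  vec_size (vec_of p) = (theta_exp 2 2 p.1.1 + theta_exp 2 2 p.1.2 + theta_exp 2 2 p.2)%N.
Proof.
have H k : (2 * `|k| ^ 2)%N = theta_exp 2 2 k.
  apply: eqn_doublez; rewrite theta_expE PoszM -abszX gez0_abs ?sqr_ge0 //; ring.
by rewrite /vec_size !big_ord_recl big_ord0 !ffunE /= !H addn0 addnA.
Qed.

Lemma vecs_exhausts : exhausts predT vec_size M vecs.
Proof.
have ex1 := @theta_exhausts M 2 2 isT isT.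
have ex := exhausts_pair (exhausts_pair ex1 ex1) ex1.
apply: exhausts_map ex => //.
- move=> [[x y] z] [[x' y'] z'] /ffunP E.
  have := E (@Ordinal 3 0 isT); have := E (@Ordinal 3 1 isT); have := E (@Ordinal 3 2 isT).
  by rewrite !ffunE /= => -> -> ->.
- move=> v _; exists (v (@Ordinal 3 0 isT), v (@Ordinal 3 1 isT), v (@Ordinal 3 2 isT)).
  by apply/ffunP => -[[|[|[|//]]] lt_j3]; rewrite ffunE /=; congr (v _); apply/val_inj.
- by move=> p; rewrite vec_sizeE.
Qed.

Lemma tri_exhausts : exhausts (fun x => 0 < x)%N triangular M (iota 1 M).
Proof.
split; first exact: iota_uniq.
  by move=> x; rewrite mem_iota => /andP[].
by move=> x x0 lt_M; rewrite mem_iota x0 /=; have := triangularE x; nia.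
Qed.

Lemma pent_exhausts :
  exhausts (fun x => x != 0) (fun k => absz (pentagonal k)) M nonzero_range.
Proof.
have [u _ c] := @theta_exhausts M 1 2 isT isT.
split; first exact: filter_uniq.
  by move=> x; rewrite mem_filter => /andP[].
by move=> x x0; rewrite pentagonalE mem_filter x0; apply: c.
Qed.

Lemma triangular_gt0 x : (0 < x)%N -> (0 < triangular x)%N.
Proof. by have := triangularE x; nia. Qed.

Lemma pentagonal_gt0 k : k != 0 -> (0 < `|pentagonal k|)%N.
Proof.
move=> k0; rewrite pentagonalE.
by have := @theta_exp_ge 1 2 k isT isT; lia.
Qed.

Lemma candidates_exhausts : exhausts valid size_of M candidates.
Proof.
have exA := exhausts_words triangular_gt0 tri_exhausts.
have exC := exhausts_words pentagonal_gt0 pent_exhausts.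
have [u P c] := exhausts_pair (exhausts_pair
  (exhausts_pair vecs_exhausts exA) exA) exC.
split => // [[[[v a] b] d] /P /=|[[[v a] b] d] vs lt_M].
  by rewrite -!andbA.
by apply: c => //=; rewrite -!andbA.
Qed.

Variables (A : comNzRingType) (q : A).
Hypothesis qM0 : q ^+ M = 0.
Local Notation theta c a b := (theta_sum q c a b M).

(** U and V are the generating functions of one triangular and of the pentagonal
    tuples; the letters have weight -1 and -(-1)^c, so that 1 minus their
    generating function is the full theta series, the index 0 supplying the 1. *)
Lemma gf_candidates : exists U V, [/\ U * theta 1 1 3 = 1, V * theta (-1) 1 2 = 1 &
  gf q size_of (fun s => (weight s)%:~R) candidates =
  theta (-1) 2 2 ^+ 3 * U ^+ 2 * V].
Proof.
exists (gf q tri_size (tri_weight A) (words (iota 1 M) M)).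
exists (gf q pent_size (pent_weight A) (words nonzero_range M)); split.
- have -> : theta 1 1 3 = 1 - gf q triangular (fun=> -1) (iota 1 M).
    rewrite (theta_triangular qM0) /gf -sumrN; congr (_ + _).
    by apply: eq_bigr => x _; rewrite mulN1r opprK mul1r.
  apply: (gf_words qM0) => x; rewrite mem_iota => /andP[x0 _].
  exact: triangular_gt0.
- have -> : theta (-1) 1 2 =
      1 - gf q (fun k => absz (pentagonal k)) (fun k => - (-1) ^+ `|k|) nonzero_range.
    rewrite theta_pentagonal /gf -sumrN; congr (_ + _).
    by apply: eq_bigr => x _; rewrite mulNr opprK.
  apply: (gf_words qM0) => x; rewrite mem_filter => /andP[x0 _].
  exact: pentagonal_gt0.
have -> : theta (-1) 2 2 ^+ 3 = gf q vec_size (vec_weight A) vecs.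
  rewrite [RHS]/gf big_map exprSr expr2 theta_gf -!gf_pair.
  apply: eq_bigr => p _; rewrite vec_sizeE; congr (_ * _).
  by rewrite /vec_weight !big_ord_recl big_ord0 !ffunE /= mulr1 mulrA.
rewrite expr2 !mulrA -!gf_pair; apply: eq_bigr => [[[[v a] b] c]] _ /=.
by rewrite weightE.
Qed.

End Candidates.

Lemma alpha_candidates n M : (n < M)%N ->
  alpha n = \sum_(s <- candidates M | size_of s == n) weight s.
Proof.
move=> lt_nM; have [u P c] := candidates_exhausts M.
rewrite -big_filter /alpha; set r := [seq s <- _ | _].
have rP s : s \in r -> is_solution n s.
  by rewrite mem_filter => /andP[sn /P vs]; apply/is_solutionE; rewrite vs.
rewrite (fsbigE r) ?filter_uniq // => [|s /= /is_solutionE /andP[vs sn]].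
  rewrite big_seq_cond [RHS]big_seq; apply: eq_bigl => s.
  by case: (boolP (s \in r)) => //= /rP; apply: mem_set.
rewrite mem_filter sn /= => /negP[].
by apply: c => //; rewrite (eqP sn).
Qed.

Section Image.
Variables (A : comNzRingType) (q : A) (M : nat).

Lemma expr_opp_sqr a : (- q ^+ 2) ^+ a = (-1) ^+ odd a * q ^+ (2 * a).
Proof. by rewrite (exprM q 2 a) (exprNn (q ^+ 2) a) -(signr_odd _ a). Qed.

Lemma distinct_image (h : {rmorphism {poly int} -> A}) a d :
  h 'X = - q ^+ 2 -> odd a -> ~~ odd d ->
  h (distinct M a d) = qinf q M 1 (2 * a) (2 * d).
Proof.
move=> hX oa ed; rewrite /distinct rmorph_qpoch rmorphN !rmorphXn hX /qinf mul1r.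
by rewrite !expr_opp_sqr oa (negPf ed) mulN1r mul1r opprK.
Qed.

Lemma parts_image (h : {rmorphism {poly int} -> A}) a d :
  h 'X = - q ^+ 2 -> ~~ odd a -> ~~ odd d ->
  h (parts M a d) = geom (q ^+ (2 * a)) (q ^+ (2 * d)) M.
Proof.
move=> hX ea ed; rewrite /parts rmorph_geom !rmorphXn hX.
by rewrite !expr_opp_sqr (negPf ea) (negPf ed) !mul1r.
Qed.

Local Notation m a d := (qinf q M 1 a d).
Local Notation g a d := (geom (q ^+ a) (q ^+ d) M).

(** The change of variable X |-> -q^2: an odd power of X turns 1 + X^e into
    1 - q^(2 e), while even powers keep their sign. *)
Lemma dissection_image (f : {rmorphism {poly int} -> A}) : f 'X = q ->
  f (even_series M \Po - 'X^2 - 'X * (odd_series M \Po - 'X^2)) =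
  m 2 16 * m 14 16 * m 2 4 ^+ 2 * (g 4 32 * g 8 32 * g 24 32 * g 28 32) -
  q * (m 6 16 * m 10 16 * m 2 4 ^+ 2 * (g 8 32 * g 12 32 * g 20 32 * g 24 32)).
Proof.
move=> fX.
pose h : {rmorphism {poly int} -> A} :=
  GRing.RMorphism.clone _ _ (f \o comp_poly (- 'X^2)) _.
have hX : h 'X = - q ^+ 2 by rewrite /h /= comp_polyX rmorphN rmorphXn fX.
transitivity (h (even_series M) - q * h (odd_series M)).
  by rewrite rmorphB (rmorphM f 'X) fX.
rewrite /even_series /odd_series !expr2 !rmorphM.
by rewrite !distinct_image // !parts_image.
Qed.

End Image.

(** The coefficient of q^n is read off in the integer polynomials modulo X^M, which
    is legitimate for n < M. *)
Lemma alpha_dissected n M : (n < M)%N ->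
  alpha n = if odd n then - (-1) ^+ n./2 * (odd_series M)`_n./2
            else (-1) ^+ n./2 * (even_series M)`_n./2.
Proof.
move=> lt_nM; have M0 : (0 < M)%N by lia.
have qM0 := to_truncX_nil M0; set f := to_trunc M in qM0.
rewrite -coef_dissection (alpha_candidates lt_nM).
pose S : {poly int} := \sum_(s <- candidates M) (weight s)%:P * 'X^(size_of s).
have -> : \sum_(s <- candidates M | size_of s == n) weight s = S`_n.
  rewrite /S coef_sum [LHS]big_mkcond; apply: eq_bigr => s _.
  by rewrite coefCM coefXn eq_sym; case: eqP; rewrite ?mulr1 ?mulr0.
apply: (to_trunc_coef M0) => //; rewrite -/f.
have -> : f S = gf (f 'X) size_of (fun s => (weight s)%:~R) (candidates M).
  rewrite /S rmorph_sum; apply: eq_bigr => s _.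
  by rewrite rmorphM rmorphXn -[weight s in LHS]intz !rmorph_int.
have [U [V [HU HV ->]]] := gf_candidates qM0.
rewrite (theta_quotient_dissection qM0 HU HV).
by rewrite (@dissection_image _ (f 'X) M f erefl).
Qed.

Unset Implicit Arguments.

Theorem corollary1p4 (n : nat) (n_gt0 : (0 < n)%N) :
  ((n = 0 %[mod 4])%N \/ (n = 3 %[mod 4])%N -> Num.sg (alpha n) = 1) /\
  ((n = 1 %[mod 4])%N \/ (n = 2 %[mod 4])%N -> Num.sg (alpha n) = -1).
Proof.
have lt_half : (n./2 < n.+1)%N by lia.
rewrite (@alpha_dissected n n.+1) //.
have sg_e : Num.sg (even_series n.+1)`_n./2 = 1 by rewrite gtr0_sg ?even_series_gt0.
have sg_o : Num.sg (odd_series n.+1)`_n./2 = 1 by rewrite gtr0_sg ?odd_series_gt0.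
have -> : Num.sg (if odd n then - (-1) ^+ n./2 * (odd_series n.+1)`_n./2
    else (-1) ^+ n./2 * (even_series n.+1)`_n./2) = (-1) ^+ (odd n (+) odd n./2).
  rewrite -signr_odd; case: odd; case: odd;
    by rewrite ?mulNr ?mulN1r ?mul1r ?sgrN ?opprK ?sg_e ?sg_o.
(* The sign (-1)^(n + floor(n / 2)) depends on n modulo 4 only. *)
have -> : odd n (+) odd n./2 = ((n %% 4 == 1) || (n %% 4 == 2))%N.
  have := divn_eq n 4; have : (n %% 4 < 4)%N by rewrite ltn_mod.
  by case: (n %% 4)%N => [|[|[|[|//]]]] _ nE; rewrite -divn2; lia.
by split=> -[] ->.
Qed.
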